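(* Let $P$ be a directed set equipped with a second-countable topology in which every convergent sequence in $P$ is bounded. Then every uncountably-dimensional locally convex space $E$ with a $P$-base contains an infinite-dimensional metrizable compact subspace.
   Context: All topological spaces are assumed to be Tychonoff; in particular, locally convex spaces (locally convex topological vector spaces) are Hausdorff. A locally convex space is uncountably-dimensional if it has an uncountable Hamel basis. A compact subspace is infinite-dimensional if its topological (covering) dimension is infinite. A poset is directed if any two elements have a common upper bound. ''Every convergent sequence is bounded'' means that whenever a sequence in $P$ converges in the given topology, the set of its terms has an upper bound in $P$. A subset $C$ of a poset $P$ is cofinal if for every $p\in P$ there is $q\in C$ with $p\leq q$. For directed sets $P,Q$, $Q$ is a Tukey quotient of $P$ if there is a map $\phi:P\to Q$ carrying cofinal subsets of $P$ to cofinal subsets of $Q$. A space $X$ has a neighborhood $P$-base at $x\in X$ if the poset of neighborhoods of $x$, ordered by reverse inclusion, is a Tukey quotient of $P$ (equivalently, there is a neighborhood base $\{U_p:p\in P\}$ at $x$ with $U_q\subseteq U_p$ whenever $p\leq q$). $X$ has a $P$-base if it has a neighborhood $P$-base at each of its points. *)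

(* Defs.v *)
From mathcomp Require Export all_boot all_order all_algebra.
From mathcomp Require Export all_classical all_reals all_analysis.

Set Implicit Arguments.
Unset Strict Implicit.
Unset Printing Implicit Defensive.

Import Order.TTheory GRing.Theory Num.Theory.
Local Open Scope classical_set_scope.
Local Open Scope ring_scope.

Definition tychonoff_space (T : topologicalType) : Prop :=
  hausdorff_space T /\ completely_regular_space T.

Section posets.
Variables (T U : Type) (leT : T -> T -> Prop) (leU : U -> U -> Prop).

Definition directed : Prop := forall p q, exists2 r, leT p r & leT q r.

Definition bounded_above (A : set T) : Prop :=
  exists p, forall a, A a -> leT a p.

Definition cofinal (C : set T) : Prop :=
  forall p, exists2 q, C q & leT p q.

End posets.

(* [tukey_quotient leP leQ]: Q is a Tukey quotient of P. *)
Definition tukey_quotient (P Q : Type)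
    (leP : P -> P -> Prop) (leQ : Q -> Q -> Prop) : Prop :=
  exists phi : P -> Q, forall C, cofinal leP C -> cofinal leQ (phi @` C).

(* Neighborhoods are not required to be open. *)
Definition nbhs_poset (X : topologicalType) (x : X) : Type :=
  {U : set X | nbhs x U}.

Definition nbhs_le (X : topologicalType) (x : X) (U V : nbhs_poset x) : Prop :=
  sval V `<=` sval U.

Definition has_nbhs_base_of_type (P : Type) (leP : P -> P -> Prop)
    (X : topologicalType) (x : X) : Prop :=
  tukey_quotient leP (@nbhs_le X x).

Definition has_base_of_type (P : Type) (leP : P -> P -> Prop)
    (X : topologicalType) : Prop :=
  forall x : X, has_nbhs_base_of_type leP x.

Section hamel.
Variables (R : fieldType) (E : lmodType R).

Definition linearly_independent (B : set E) : Prop :=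
  forall (s : seq E) (c : E -> R), uniq s -> [set` s] `<=` B ->
    \sum_(x <- s) c x *: x = 0 -> forall x, x \in s -> c x = 0.

Definition spanning (B : set E) : Prop :=
  forall v : E, exists (s : seq E) (c : E -> R),
    [set` s] `<=` B /\ v = \sum_(x <- s) c x *: x.

Definition hamel_basis (B : set E) : Prop :=
  linearly_independent B /\ spanning B.

Definition uncountably_dimensional : Prop :=
  exists2 B : set E, hamel_basis B & ~ countable B.

End hamel.

Definition metrizable (R : realType) (T : topologicalType) : Prop :=
  exists d : T -> T -> R,
    [/\ forall x y, 0 <= d x y,
        forall x y, d x y = 0 <-> x = y,
        forall x y, d x y = d y x,
        forall x y z, d x z <= d x y + d y z &
        forall (x : T) (U : set T),
          nbhs x U <-> exists2 e : R, 0 < e & [set y | d x y < e] `<=` U].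

Definition open_cover (T : topologicalType) (U : set (set T)) : Prop :=
  U `<=` open /\ \bigcup_(A in U) A = [set: T].

Definition refines (T : Type) (V U : set (set T)) : Prop :=
  forall B, V B -> exists2 A, U A & B `<=` A.

(* dim T <= n: every finite open cover has a finite open refinement in which
   each point lies in at most n + 1 members.  For non-normal Tychonoff spaces
   one would restrict to covers by cozero sets; here the dimension is only
   applied to compact Hausdorff spaces, where the definitions coincide. *)
Definition covering_dim_le (T : topologicalType) (n : nat) : Prop :=
  forall U : set (set T), finite_set U -> open_cover U ->
    exists V : set (set T),
      [/\ finite_set V, open_cover V, refines V U &
          forall x : T, ([set B | V B /\ B x] #<= `I_n.+1)%card].

Definition infinite_dimensional (T : topologicalType) : Prop :=
  forall n : nat, ~ covering_dim_le T n.

(* Main.v *)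
Require Import Defs.
From mathcomp Require Import all_fingroup zify lra ring.

Set Implicit Arguments.
Unset Strict Implicit.
Unset Printing Implicit Defensive.

Import Order.TTheory GRing.Theory Num.Theory numFieldNormedType.Exports.
Local Open Scope classical_set_scope.
Local Open Scope ring_scope.

(* Intersecting the members [U_q] of a [P]-base at [0] over the elements of a
   countable base of [P] gives a countable family [A] such that every
   neighborhood of [0] contains some [A_i] absorbing a prescribed point.  A
   condensation argument then extracts from an uncountable Hamel basis an
   injective sequence [u] that is bounded in [E].  Therefore
   [p |-> \sum_i p_i u_i] is a continuous linear injection into [E] of the
   finitely supported sequences [p], encoded as polynomials, with the l1 norm.
   The set of [p] such that [n * |p|_1 <= 1] for some [n] bounding the size of
   the support is l1-compact and contains cubes of all finite dimensions; its
   image is the required compact set.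

   The Lebesgue covering theorem for cubes is obtained as follows.  Let [f] be a
   function from a grid on the [m]-cube to Q^m with [f_i = 0] on the face
   [x_i = 0] and [f_i = 1] on the opposite one.  The signed sum of
   [det (1 | f(v_0), ..., f(v_m))] over the simplices of the Kuhn triangulation
   telescopes to [m!], hence some simplex has [m + 1] distinct values.  When [f]
   depends only on a member of the cover containing a neighborhood of the point,
   these [m + 1] values come from [m + 1] members with a common point. *)

(** * Kuhn's triangulation of the cube *)

(* [s i] is the rank of coordinate [i] in the order of the increments, i.e. [s]
   is the inverse of the permutation usually indexing Kuhn's simplices. *)
Definition kuhn_vertex m (a : 'I_m -> nat) (s : 'S_m) (k : nat) : 'I_m -> nat :=
  fun i => (a i + (s i < k))%N.

(** This is m! times the signed volume of the simplex of values; [unlift ord0 j] is [None] exactly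
    at [j = ord0], which makes that column constant 1. *)
Definition kuhn_det m (f : ('I_m -> nat) -> 'I_m -> rat) a (s : 'S_m) : rat :=
  \det (\matrix_(k < m.+1, j < m.+1)
    oapp (f (kuhn_vertex a s k)) 1 (unlift ord0 j)).

Definition facet_det m (f : ('I_m -> nat) -> 'I_m -> rat) a (s : 'S_m)
    (j : 'I_m.+1) : rat :=
  \det (\matrix_(k < m, i < m) f (kuhn_vertex a s (lift j k)) i).

Lemma kuhn_detE m f a (s : 'S_m) :
  kuhn_det f a s = \sum_(j < m.+1) (-1) ^+ j * facet_det f a s j.
Proof.
rewrite /kuhn_det (expand_det_col _ ord0); apply: eq_bigr => j _.
rewrite mxE unlift_none /= mul1r /cofactor addn0; congr (_ * \det _).
by apply/matrixP => k i; rewrite !mxE liftK.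
Qed.

(** Swapping the consecutive ranks [j] and [j.+1] moves only vertex number [j.+1], so the two
    simplices share the facet opposite it. *)
Lemma facet_det_tperm m f a (s : 'S_m.+1) (j : 'I_m) :
  facet_det f a (s * tperm (widen_ord (leqnSn m) j) (lift ord0 j))%g
    (lift ord0 (widen_ord (leqnSn m) j)) =
  facet_det f a s (lift ord0 (widen_ord (leqnSn m) j)).
Proof.
congr (\det _); apply/matrixP => k i; rewrite !mxE; congr (f _ _).
apply/funext => l; rewrite /kuhn_vertex permM; congr (_ + nat_of_bool _)%N.
set K := @lift m.+2 _ k; have : (K : nat) != j.+1.
  rewrite (inj_eq val_inj K (lift ord0 (widen_ord (leqnSn m) j))) eq_sym.
  exact: neq_lift.
case: tpermP => [->|->|//]; rewrite /= /bump /= ?add1n; lia.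
Qed.

(** The two simplices sharing such a facet have opposite signs. *)
Lemma sum_facet_det_inner m f a (j : 'I_m) :
  \sum_(s : 'S_m.+1) (-1) ^+ s *
    facet_det f a s (lift ord0 (widen_ord (leqnSn m) j)) = 0.
Proof.
set X := LHS; suff : X = - X.
  by move=> /eqP; rewrite -addr_eq0 -mulr2n mulrn_eq0 => /eqP.
set t := tperm (widen_ord (leqnSn m) j) (lift ord0 j).
rewrite {1}/X (reindex_inj (mulIg t)) /= -sumrN; apply: eq_bigr => s _.
rewrite facet_det_tperm odd_permM odd_tperm.
have -> : widen_ord (leqnSn m) j != lift ord0 j.
  by apply/eqP => /(congr1 val) /=; rewrite /bump /=; lia.
by rewrite signr_addb mulrN1 mulNr.
Qed.

Definition insert_coord m (i : 'I_m.+1) (y : nat) (b : 'I_m -> nat) :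
    'I_m.+1 -> nat :=
  fun j => oapp b y (unlift i j).

Lemma insert_coord_at m (i : 'I_m.+1) y b : insert_coord i y b i = y.
Proof. by rewrite /insert_coord unlift_none. Qed.

Lemma insert_coord_lift m (i : 'I_m.+1) y b j :
  insert_coord i y b (lift i j) = b j.
Proof. by rewrite /insert_coord liftK. Qed.

Definition fun_ord m N (a : {ffun 'I_m -> 'I_N}) : 'I_m -> nat := fun i => a i.

Lemma sum_insert_coord m N (i : 'I_m.+1) (G : ('I_m.+1 -> nat) -> rat) :
  \sum_(a : {ffun 'I_m.+1 -> 'I_N}) G (fun_ord a) =
  \sum_(b : {ffun 'I_m -> 'I_N}) \sum_(y < N) G (insert_coord i y (fun_ord b)).
Proof.
rewrite exchange_big pair_big /=.
pose h (p : 'I_N * {ffun 'I_m -> 'I_N}) : {ffun 'I_m.+1 -> 'I_N} :=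
  [ffun j => oapp p.2 p.1 (unlift i j)].
pose h' (a : {ffun 'I_m.+1 -> 'I_N}) := (a i, [ffun j => a (lift i j)]).
rewrite (reindex h) /=; last first.
  exists h' => [[y b] _|a _]; rewrite /h /h' /=.
    rewrite ffunE unlift_none /=; congr pair; apply/ffunP => j.
    by rewrite !ffunE liftK.
  apply/ffunP => j; rewrite ffunE.
  by case: unliftP => [k|] -> /=; rewrite ?ffunE.
apply: eq_bigr => -[y b] _; congr G; apply/funext => j.
by rewrite /fun_ord /insert_coord ffunE; case: (unlift i j).
Qed.

Definition facet_last m f a (s : 'S_m.+1) := facet_det f a s ord_max.

(** Both sides come from the same facet in the hyperplane [x_i = y.+1] between adjacent cubes: in
    the lower cube [i] is incremented first, in the upper one last. *)
Lemma facet_det_rot m f (s : 'S_m.+1) (i : 'I_m.+1) y b : s i = ord_max ->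
  facet_det f (insert_coord i y b) (s * lift_perm ord_max ord0 1)%g ord0 =
  facet_last (m := m) f (insert_coord i y.+1 b) s.
Proof.
move=> si; congr (\det _); apply/matrixP => k l; rewrite !mxE; congr (f _ _).
apply/funext => j; rewrite /kuhn_vertex permM.
have -> : (lift ord_max k : nat) = k by rewrite lift_max.
have -> : (lift ord0 k : nat) = k.+1 by [].
case: (unliftP i j) => [j'|] ->.
  rewrite !insert_coord_lift; have : s (lift i j') != ord_max.
    by rewrite -si (inj_eq perm_inj) eq_sym neq_lift.
  case: (unliftP ord_max (s (lift i j'))) => [c|] -> ; rewrite ?eqxx// => _;
  rewrite lift_perm_lift perm1 lift_max /= /bump leq0n; lia.
rewrite !insert_coord_at si lift_perm_id /=; have := ltn_ord k; lia.
Qed.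

Definition face m (N : nat) (i : 'I_m.+1)
    (f : ('I_m.+1 -> nat) -> 'I_m.+1 -> rat) : ('I_m -> nat) -> 'I_m -> rat :=
  fun b j => f (insert_coord i N b) (lift i j).

Lemma kuhn_vertex_insert m (i : 'I_m.+1) y b (s : 'S_m) k : (k <= m)%N ->
  kuhn_vertex (insert_coord i y b) (lift_perm i ord_max s) k =
  insert_coord i y (kuhn_vertex b s k).
Proof.
move=> km; apply/funext => j; rewrite /kuhn_vertex.
case: (unliftP i j) => [j'|] ->.
  by rewrite !insert_coord_lift lift_perm_lift lift_max.
rewrite !insert_coord_at lift_perm_id /=; lia.
Qed.

Lemma facet_last_lower m f (i : 'I_m.+1) b (s : 'S_m) :
  (forall x, x i = 0%N -> f x i = 0) ->
  facet_last f (insert_coord i 0 b) (lift_perm i ord_max s) = 0.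
Proof.
move=> f0; rewrite /facet_last /facet_det (expand_det_col _ i) big1// => k _.
rewrite mxE lift_max kuhn_vertex_insert; last by rewrite -ltnS.
by rewrite f0 ?mul0r// insert_coord_at.
Qed.

(** Column [i] of the minor is constant 1 on this face and becomes the column of ones in dimension
    [m]; moving it to the front costs [(-1) ^+ i]. *)
Lemma facet_last_upper m f N (i : 'I_m.+1) b (s : 'S_m) :
  (forall x, x i = N -> f x i = 1) ->
  facet_last f (insert_coord i N b) (lift_perm i ord_max s) =
  (-1) ^+ i * kuhn_det (face N i f) b s.
Proof.
move=> f1; rewrite kuhn_detE /facet_last /facet_det (expand_det_col _ i).
rewrite big_distrr; apply: eq_bigr => k _.
rewrite mxE lift_max kuhn_vertex_insert; last by rewrite -ltnS.
rewrite f1 ?insert_coord_at// mul1r.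
rewrite /cofactor exprD -[RHS]/((-1) ^+ i * ((-1) ^+ k * _)) mulrA.
rewrite [(-1) ^+ k * _]mulrC; congr (_ * \det _).
apply/matrixP => p q; rewrite !mxE lift_max kuhn_vertex_insert; first by [].
by rewrite -ltnS.
Qed.

Lemma sum_perm_last m (F : 'S_m.+1 -> rat) :
  \sum_s F s = \sum_(i < m.+1) \sum_(s : 'S_m) F (lift_perm i ord_max s).
Proof.
rewrite (partition_big (fun s : 'S_m.+1 => s^-1 ord_max)%g predT)//=.
apply: eq_bigr => i _.
rewrite (reindex (lift_perm i ord_max)); last first.
  (* [ulsf i s] deletes [i] from the domain of [s] and [s i] from its range, which inverts
     [lift_perm]. *)
  pose ulsf i (s : 'S_m.+1) k := odflt k (unlift (s i) (s (lift i k))).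
  have ulsfK i' (s : 'S_m.+1) k : lift (s i') (ulsf i' s k) = s (lift i' k).
    rewrite /ulsf; have:= neq_lift i' k.
    by rewrite -(can_eq (permK s)) => /unlift_some[] ? ? ->.
  have inj_ulsf : injective (ulsf i _).
    move=> s; apply: can_inj (ulsf (s i) s^-1%g) _ => k'.
    by rewrite {1}/ulsf ulsfK !permK liftK.
  exists (fun s => perm (inj_ulsf s)) => [s _ | s].
    by apply/permP=> k'; rewrite permE /ulsf lift_perm_lift lift_perm_id liftK.
  rewrite inE => /eqP si; have si' : s i = ord_max by rewrite -si permKV.
  apply/permP=> k; case: (unliftP i k) => [k'|] ->; rewrite ?lift_perm_id //.
  by rewrite lift_perm_lift -si' permE ulsfK.
apply: eq_bigl => s; apply/eqP; apply: (@perm_inj _ (lift_perm i ord_max s)).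
by rewrite permKV lift_perm_id.
Qed.

(** Induction on [m]: facets inside a cube cancel in pairs, those between adjacent cubes telescope,
    and each face [x_i = N] contributes the sum of one dimension less. *)
Lemma sum_kuhn_det m N (f : ('I_m -> nat) -> 'I_m -> rat) :
  (forall x i, x i = 0%N -> f x i = 0) -> (forall x i, x i = N -> f x i = 1) ->
  \sum_(s : 'S_m) \sum_(a : {ffun 'I_m -> 'I_N})
    (-1) ^+ s * kuhn_det f (fun_ord a) s = m`!%:R.
Proof.
elim: m f => [|m IH] f f0 f1.
  rewrite (bigD1 1%g)//= [X in _ + X]big1 ?addr0; last first.
    by move=> s /eqP []; apply/permP => -[].
  have /card1P[a0 a0P] : #|{ffun 'I_0 -> 'I_N}| == 1%N.
    by rewrite card_ffun !card_ord expn0.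
  rewrite (bigD1 a0)//= big1 ?addr0; last first.
    by move=> a /eqP []; apply/eqP; move: (a0P a); rewrite !inE => <-.
  by rewrite odd_perm1 mul1r /kuhn_det det_mx11 mxE /= unlift_none.
set G := fun (s : 'S_m.+1) a => facet_last f a s.
have -> : \sum_(s : 'S_m.+1) \sum_(a : {ffun 'I_m.+1 -> 'I_N})
    (-1) ^+ s * kuhn_det f (fun_ord a) s =
  \sum_(s : 'S_m.+1) \sum_(a : {ffun 'I_m.+1 -> 'I_N})
    (-1) ^+ s *
      (facet_det f (fun_ord a) s ord0 + (-1) ^+ m.+1 * G s (fun_ord a)).
  rewrite exchange_big [RHS]exchange_big; apply: eq_bigr => a _ /=.
  under eq_bigr do
    rewrite kuhn_detE big_ord_recl big_ord_recr /= !mulrDr expr0 mul1r.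
  under [RHS]eq_bigr do rewrite mulrDr.
  rewrite !big_split /=; congr (_ + _).
  have -> : lift ord0 ord_max = ord_max :> 'I_m.+2 by apply/val_inj.
  rewrite -[RHS]add0r; congr (_ + _).
  under eq_bigr do rewrite big_distrr.
  rewrite exchange_big big1// => j _ /=.
  under eq_bigr do rewrite mulrCA.
  by rewrite -big_distrr /= sum_facet_det_inner mulr0.
under eq_bigr do (under eq_bigr do rewrite mulrDr);
under eq_bigr do rewrite big_split; rewrite big_split /=.
rewrite (reindex_inj (mulIg (lift_perm ord_max ord0 1%g))) /= -big_split /=.
rewrite sum_perm_last.
rewrite (_ : m.+1`!%:R = \sum_(i < m.+1) m`!%:R); last first.
  by rewrite sumr_const card_ord factS natrM mulrC mulr_natr.
apply: eq_bigr => i _; rewrite -(IH (face N i f)); last 2 first.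
- by move=> x j xj; rewrite /face f0// insert_coord_lift.
- by move=> x j xj; rewrite /face f1// insert_coord_lift.
apply: eq_bigr => s _.
set t := lift_perm i ord_max s.
rewrite (sum_insert_coord N i
  (fun a => (-1) ^+ (t * _)%g * facet_det f a (t * _)%g ord0)).
rewrite (sum_insert_coord N i (fun a => (-1) ^+ t * ((-1) ^+ m.+1 * G t a))).
rewrite -big_split /=.
apply: eq_bigr => b _; rewrite -big_split /=.
under eq_bigr do rewrite facet_det_rot ?lift_perm_id// -/(G t _).
(* The rotation of ranks is a cycle of length [m.+1]; its sign is opposite to that of the last
   facet, so a difference appears. *)
have -> : ((-1) ^+ (t * lift_perm ord_max ord0 1)%g : rat) =
    (-1) ^+ t * (-1) ^+ m.
  rewrite odd_permM signr_addb odd_lift_perm odd_perm1.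
  by rewrite addbF /= addbF signr_odd.
under eq_bigr do rewrite -mulrA -mulrDr exprS mulN1r mulNr -mulrBr mulrA.
pose H y := G t (insert_coord i y (fun_ord b)).
rewrite -big_distrr /= -(big_mkord xpredT (fun y => H y.+1 - H y)).
rewrite telescope_sumr// /H {1}/G facet_last_upper; last by move=> x; exact: f1.
rewrite /G facet_last_lower; last by move=> x; exact: f0.
rewrite subr0 mulrA; congr (_ * _).
(* The sign of [t] is that of [s] times [(-1) ^+ (i + m)], which absorbs the other two signs. *)
rewrite /t odd_lift_perm -(signr_odd _ m) -(signr_odd _ i).
move: (odd_perm s) => o /=.
by case: o; case: (odd i); case: (odd m); rewrite /=; ring.
Qed.

Lemma cube_distinct_values m N (f : ('I_m -> nat) -> 'I_m -> rat) :
  (forall x i, x i = 0%N -> f x i = 0) -> (forall x i, x i = N -> f x i = 1) ->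
  exists v : 'I_m.+1 -> 'I_m -> nat, injective (f \o v) /\
    forall j k i, (v j i <= (v k i).+1)%N.
Proof.
move=> f0 f1.
have [s [a sa]] : exists s a, kuhn_det f a s != 0 :> rat.
  apply: contrapT => H; have := sum_kuhn_det f0 f1.
  rewrite big1 => [/esym/eqP|s _].
    by rewrite pnatr_eq0 eqn0Ngt fact_gt0.
  rewrite big1// => a _.
  have [->|/eqP ne] := eqVneq (kuhn_det f (fun_ord a) s) 0.
    by rewrite mulr0.
  by exfalso; apply: H; exists s, (fun_ord a); apply/eqP.
exists (fun k => kuhn_vertex a s k); split => [j k /= fjk|j k i].
  apply/eqP; apply: contraNT sa => jk; apply/eqP.
  apply: (determinant_alternate jk) => i; rewrite !mxE; congr (oapp _ _ _).
  exact: fjk.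
by rewrite /kuhn_vertex; lia.
Qed.

(** * A bounded linearly independent sequence *)

Lemma tukey_monotone_base (P : Type) (leP : P -> P -> Prop)
    (X : topologicalType) (x : X) :
  (forall p, leP p p) -> (forall p q r, leP p q -> leP q r -> leP p r) ->
  has_nbhs_base_of_type leP x ->
  exists U : P -> set X,
    [/\ forall p, nbhs x (U p), forall p q, leP p q -> U q `<=` U p &
        forall V, nbhs x V -> exists p, U p `<=` V].
Proof.
move=> refl trans [phi phi_cofinal].
exists (fun p => [set y | exists2 q, leP p q & sval (phi q) y]); split.
- move=> p; apply: filterS (svalP (phi p)) => y py.
  by exists p.
- by move=> p q pq y [r qr ry]; exists r => //; exact: trans qr.
move=> V xV; apply: contrapT => noV.
(* If no member fits in [V], these [q] form a cofinal set, whose image has to contain a subset of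
   [V]. *)
have C_cofinal : cofinal leP [set q | ~ sval (phi q) `<=` V].
  move=> p; apply: contrapT => H; apply: noV; exists p => y [q pq qy].
  by apply: contrapT => nVy; apply: H; exists q => //= /(_ _ qy).
have [W [q qV <-]] := phi_cofinal _ C_cofinal (exist _ V xV).
by move=> /qV.
Qed.

(** For a suitable [b] every set [N b k], formed with the first [k] of the [S i], is uncountable;
    [u k] is picked in [N b k] away from the earlier terms. *)
Lemma condensation_sequence (T : choiceType) (B : set T) (S : nat -> set T) :
  ~ countable B ->
  exists (b : T) (u : nat -> T), [/\ B b, injective u, forall k, B (u k) &
    forall i k, S i b -> (i < k)%N -> S i (u k)].
Proof.
move=> uncB.
pose N b k := B `&` [set x | forall i, (i < k)%N -> S i b -> S i x].
have [b [Bb Nb]] : exists b, B b /\ forall k, ~ countable (N b k).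
  (* Otherwise [B] is covered by the countable ones among the sets [D s], and there are countably
     many finite lists [s]. *)
  apply: contrapT => noB; apply: uncB.
  pose D (s : seq nat) := B `&` [set x | forall i, i \in s -> S i x].
  apply: (@sub_countable _ _ _ (\bigcup_(s in [set s | countable (D s)]) D s)).
    apply: subset_card_le => b Bb.
    have [k Nbk] : exists k, countable (N b k).
      apply: contrapT => H; apply: noB; exists b; split=> // k ck.
      by apply: H; exists k.
    exists [seq i <- iota 0 k | `[< S i b >]] => /=.
      apply: (sub_countable _ Nbk); apply: subset_card_le => x [Bx Dx].
      split=> // i ik Sib; apply: Dx; rewrite mem_filter mem_iota.
      by apply/andP; split; [exact/asboolP|].
    by split=> // i; rewrite mem_filter => /andP[/asboolP].
  by apply: bigcup_countable => //; exact: countableP.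
have /choice[x xP] : forall p : nat * seq T, exists y,
    N b p.1 y /\ y \notin p.2.
  case=> k s /=; apply: contrapT => H; apply: (Nb k).
  apply: (@sub_countable _ _ _ [set` s]); last exact: finite_set_countable.
  apply: subset_card_le => y Ny /=; apply: contrapT => /negP ys; apply: H.
  by exists y.
pose l := fix l k := if k is k'.+1 then x (k', l k') :: l k' else [::].
pose u k := x (k, l k).
have mem_l j k : (j < k)%N -> u j \in l k.
  elim: k => // k IH; rewrite ltnS leq_eqVlt => /orP[/eqP ->|/IH jk].
    by rewrite /= mem_head.
  by rewrite /= inE jk orbT.
have uP k := xP (k, l k).
exists b, u; split=> //.
- move=> j k ujk; apply/eqP; apply: contraT; rewrite neq_ltn => /orP[] /mem_l.
    by rewrite ujk => jk; have [_ /negP] := uP k.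
  by rewrite -ujk => jk; have [_ /negP] := uP j.
- by move=> k; have [[]] := uP k.
- by move=> i k Sib ik; have [[_ /= H] _] := uP k; exact: H.
Qed.

Definition absolutely_convex (R : realType) (E : lmodType R) (C : set E) :=
  forall x y (s t : R), C x -> C y -> `|s| + `|t| <= 1 -> C (s *: x + t *: y).

(** A convex neighborhood [D] of 0 is symmetrized by intersecting it with [- D]. *)
Lemma absolutely_convex_nbhs (R : realType) (E : tvsType R) (V : set E) :
  nbhs 0 V -> exists C, [/\ nbhs 0 C, C `<=` V & absolutely_convex C].
Proof.
move=> V0; have [B Bconv [Bo Bb]] := @locally_convex R E.
have [D [BD D0] DV] := Bb 0 V V0.
have Dconv x y t : D x -> D y -> 0 <= t -> t <= 1 -> D (t *: x + (1 - t) *: y).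
  move=> Dx Dy t0 t1.
  have := Bconv D (mem_set BD) x y (Itv01 t0 t1) (mem_set Dx) (mem_set Dy).
  by move=> /set_mem.
have nD : nbhs 0 D by apply: open_nbhs_nbhs; split=> //; exact: Bo.
have Dsg x (s : R) : D x -> D (- x) -> D (Num.sg s *: x).
  by case: sgrP => _; rewrite ?scale0r ?scale1r ?scaleN1r.
have key x y s t : D x -> D (- x) -> D y -> D (- y) -> `|s| + `|t| <= 1 ->
    D (s *: x + t *: y).
  move=> Dx Dnx Dy Dny st1; set r := _ + _ in st1.
  have r0 : 0 <= r by rewrite addr_ge0.
  have [rz|rn0] := eqVneq r 0.
    move: rz => /eqP; rewrite /r paddr_eq0// !normr_eq0.
    move=> /andP[/eqP -> /eqP ->].
    by rewrite !scale0r addr0.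
  have rK a : r * (`|a| * (r^-1 * Num.sg a)) = a.
    by rewrite mulrCA mulVKf// mulrC -numEsg.
  (* A convex combination of [Num.sg s *: x] and [Num.sg t *: y] is averaged with 0. *)
  have -> : s *: x + t *: y = r *: ((`|s| / r) *: (Num.sg s *: x) +
      (1 - `|s| / r) *: (Num.sg t *: y)) + (1 - r) *: 0.
    rewrite scaler0 addr0 scalerDr !scalerA.
    have -> : 1 - `|s| / r = `|t| / r.
      by apply: (mulIf rn0); rewrite mulrBl !mulfVK// mul1r /r addrC addKr.
    by rewrite -!mulrA !rK.
  apply: (Dconv) => //; apply: (Dconv); first exact: Dsg.
  - exact: Dsg.
  - by rewrite divr_ge0.
  - by rewrite ler_pdivrMr ?lt_def ?rn0// mul1r lerDl.
exists (D `&` [set x | D (- x)]); split.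
- apply: filterI => //; have := nbhs0N nD; apply: filterS => x [y Dy <-].
  by rewrite /= opprK.
- by move=> x [/DV].
move=> x y s t [Dx Dnx] [Dy Dny] st; split; first exact: key.
rewrite /= opprD -!scalerN; apply: key; rewrite ?opprK//.
Qed.

Lemma absolutely_convex_sum (R : realType) (E : lmodType R) (C : set E)
    (y : nat -> E) (c : nat -> R) n :
  absolutely_convex C -> (forall i, C (y i)) ->
  \sum_(i < n) `|c i| <= 1 -> C (\sum_(i < n) c i *: y i).
Proof.
move=> Cac Cy; have C0 : C 0.
  rewrite -[0]addr0 -{1}(scale0r (y 0%N)) -(scale0r (y 0%N)).
  by apply: Cac => //; rewrite normr0 addr0.
(* Normalizing by the total weight lets the induction run without a bound on the weights. *)
have [z Cz ->] : exists2 z, C z &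
    \sum_(i < n) c i *: y i = (\sum_(i < n) `|c i|) *: z.
  elim: n => [|n [z Cz IH]]; first by exists 0; rewrite // !big_ord0 scaler0.
  rewrite !big_ord_recr /= IH; pose r : R := \sum_(i < n) `|c i|.
  rewrite -/r; pose r' : R := r + `|c n|; rewrite -/r'.
  have r0 : 0 <= r by rewrite sumr_ge0.
  have [rz|rn0] := eqVneq r' 0.
    move: rz => /eqP; rewrite /r' paddr_eq0// normr_eq0.
    move=> /andP[/eqP -> /eqP ->].
    by exists 0 => //; rewrite !scale0r scaler0 addr0.
  exists ((r / r') *: z + (c n / r') *: y n).
    apply: Cac => //; rewrite !normrM !normfV -mulrDl (ger0_norm r0).
    by rewrite -/r' ger0_norm ?addr_ge0// mulfV.
  by rewrite scalerDr !scalerA ![_ * (_ / r')]mulrC !mulfVK.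
move=> n1; rewrite -[_ *: z]addr0 -(scale0r (0 : E)).
by apply: Cac => //; rewrite normr0 addr0 ger0_norm ?sumr_ge0.
Qed.

Lemma absorbing_nbhs (R : realType) (E : tvsType R) (V : set E) (x : E) :
  nbhs 0 V -> \forall n \near \oo, V (n.+1%:R^-1 *: x).
Proof.
move=> V0.
have : ((fun n : nat => (n.+1%:R^-1 : R^o)) @ \oo) --> (0 : R^o).
  exact: cvg_harmonic.
move=> cv.
have := @scale_continuous R E (0, x) V; rewrite /= scale0r => /(_ V0).
move=> [[A1 A2] /= [A10 A2x] sub].
have := cv _ A10; move=> H; near=> n; have An : A1 (n.+1%:R^-1) by near: n.
by apply: (sub (n.+1%:R^-1, x)); split=> //=; exact: nbhs_singleton.
Unshelve. all: by end_near.
Qed.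

(* The sets [A i] are the intersections of the base neighborhoods over the
   members of a countable base of [P]; a sequence converging to [p] being
   bounded makes the ones indexed by neighborhoods of [p] absorb points. *)
Lemma radial_network (d : Order.disp_t) (P : POrderedTopological.type d)
    (R : realType) (E : tvsType R) :
  @second_countable P ->
  (forall (u : nat -> P) (l : P), u n @[n --> \oo] --> l ->
     bounded_above (fun p q : P => (p <= q)%O) (range u)) ->
  has_nbhs_base_of_type (fun p q : P => (p <= q)%O) (0 : E) ->
  exists A : nat -> set E, forall V x, nbhs 0 V ->
    exists i n, A i `<=` V /\ A i (n.+1%:R^-1 *: x).
Proof.
move=> [B Bcount [Bo Bb]] Pbound /tukey_monotone_base[||U [U0 Umono Ubase]].
- exact: lexx.
- by move=> p q r; exact: le_trans.
have [p0 _] := Ubase setT filterT.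
move: Bcount => /pfcard_geP[B0|[e]].
  by have [W []] := Bb p0 setT filterT; rewrite B0.
exists (fun i => [set y | forall q, e i q -> U q y]) => V x /Ubase[p UpV].
apply: contrapT => H.
have nbhsG k : nbhs p [set q | forall i : 'I_k, e i p -> e i q].
  apply: filter_forall => i; have [eip|neip] := pselect (e i p).
    apply: (@filterS _ _ _ (e i)) => //; apply: open_nbhs_nbhs; split=> //.
    by apply: Bo; exact: funS.
  by apply: (@filterS _ _ _ setT) => //; exact: filterT.
(* Otherwise a whole basic neighborhood [W] of [p] has [x / (k + 1)] in all its [U q], and the set
   indexed by [W] is as required. *)
have /choice[q qP] : forall k, exists q,
    (forall i : 'I_k, e i p -> e i q) /\ ~ U q (k.+1%:R^-1 *: x).
  move=> k; apply: contrapT => Hk.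
  have [W [BW Wp] Wsub] := Bb p _ (nbhsG k).
  have [i _ eiW] := (@surj _ _ _ _ e) W BW.
  apply: H; exists i, k; rewrite eiW; split=> [y Wy|q Wq].
    by apply: UpV; exact: Wy.
  by apply: contrapT => nU; apply: Hk; exists q; split=> //; exact: Wsub.
(* For an upper bound [r], [U r] lies in every [U (q k)] and yet absorbs [x]. *)
have /Pbound[r rP] : q n @[n --> \oo] --> p.
  move=> O /Bb[W [BW Wp] WO].
  have [i _ eiW] := (@surj _ _ _ _ e) W BW.
  exists i.+1 => // k /= ik; apply: WO.
  have [/(_ (Ordinal ik)) /= + _] := qP k.
  by rewrite eiW => /(_ Wp).
have [k _ /(_ k (leqnn _)) /= Urk] := absorbing_nbhs x (U0 r).
have [_] := qP k; apply; apply: Umono Urk; apply: rP.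
by exists k.
Qed.

Lemma bounded_sequence (R : realType) (E : tvsType R) (B : set E)
    (A : nat -> set E) :
  (forall V x, nbhs 0 V -> exists i n, A i `<=` V /\ A i (n.+1%:R^-1 *: x)) ->
  ~ countable B ->
  exists u : nat -> E, [/\ injective u, forall k, B (u k) &
    forall V, nbhs 0 V -> exists n, forall k, V (n.+1%:R^-1 *: u k)].
Proof.
(* The sets are the dilates of the [A i] by [n.+1], enumerated by the codes of the pairs [(i, n)]; a
   number coding no pair gets the whole space. *)
move=> radA /(@condensation_sequence E B
  (fun m => if unpickle m is Some (i, n) then
     [set x | A i (n.+1%:R^-1 *: x)] else setT)).
case=> [b [u [Bb uinj Bu uP]]]; exists u; split=> // V V0.
have [C [C0 CV Cac]] := absolutely_convex_nbhs V0.
have shrink m n x : (m <= n)%N -> C (m.+1%:R^-1 *: x) -> C (n.+1%:R^-1 *: x).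
  move=> mn Cx; rewrite -[_ *: x]addr0 -(scale0r (0 : E)).
  have -> : n.+1%:R^-1 *: x = (m.+1%:R / n.+1%:R : R) *: (m.+1%:R^-1 *: x).
    by rewrite scalerA mulrAC mulfV ?mul1r// pnatr_eq0.
  apply: Cac => //; first exact: nbhs_singleton.
  rewrite normr0 addr0 ger0_norm ?divr_ge0// ler_pdivrMr ?ltr0n// mul1r.
  by rewrite ler_nat.
have [i [n [AC Ab]]] := radA C b C0.
have Ck k : (pickle (i, n) < k)%N -> C (n.+1%:R^-1 *: u k).
  by move=> /(uP (pickle (i, n)) k); rewrite pickleK /= => /(_ Ab) /AC.
have /choice[f fP] k : exists m, C (m.+1%:R^-1 *: u k).
  by have [m _ /(_ m (leqnn _))] := absorbing_nbhs (u k) C0; exists m.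
(* Beyond the code of [(i, n)] one factor serves all terms; the finitely many others are absorbed
   one by one. *)
exists (maxn n (\max_(k < (pickle (i, n)).+1) f k)) => k; apply: CV.
have [/Ck|] := ltnP (pickle (i, n)) k; first by apply: shrink; exact: leq_maxl.
rewrite -ltnS => ki; apply: shrink (fP k).
by rewrite leq_max; apply/orP; right; exact: (leq_bigmax (Ordinal ki)).
Qed.

(** * An l1-compact set of polynomials *)

Section ultra_compact.
Variables (R : realType) (T : Type) (d : T -> T -> R) (Q : set T).

(** Compactness by ultrafilters converging for [d], so that [T] need not carry a topology. *)
Definition ultra_compact := forall G : set_system T, UltraFilter G -> G Q ->
  exists2 q, Q q & forall e, 0 < e -> G [set p | d p q < e].

Variables (X : topologicalType) (f : T -> X).
Hypothesis Qcompact : ultra_compact.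
Hypothesis fcont : forall q V, Q q -> nbhs (f q) V ->
  exists2 e, 0 < e & forall p, Q p -> d p q < e -> V (f p).

Lemma image_compact : compact (f @` Q).
Proof.
rewrite compact_ultra => F FU FQ.
have PF : ProperFilter (filter_from F (fun B => Q `&` f @^-1` B)).
  apply: filter_from_proper.
    apply: filter_from_filter; first by exists setT; exact: filterT.
    by move=> A B FA FB; exists (A `&` B) => [|x [Qx []]//]; exact: filterI.
  move=> B FB; have [_ [[q Qq <-] Bq]] := filter_ex (filterI FQ FB).
  by exists q.
have [G [GU FG]] := ultraFilterLemma PF.
have GB B : F B -> G (Q `&` f @^-1` B) by move=> FB; apply: FG; exists B.
have GQ : G Q by apply: filterS (GB setT filterT) => x [].
have [q Qq Gq] := Qcompact GU GQ.
exists (f q); split; first by exists q.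
move=> V /(fcont Qq)[e e0 eV].
have [//|FnV] := in_ultra_setVsetC V FU.
have [p [[Qp pe] [_ nVp]]] :=
  filter_ex (filterI (filterI GQ (Gq e e0)) (GB _ FnV)).
by exfalso; apply: nVp; exact: eV.
Qed.

(** A continuous injection of a compact set into a Hausdorff space is an embedding: otherwise points
    with images tending to [f q] outside [U] accumulate at some [q'] with [f q' = f q]. *)
Lemma image_nbhs (q : T) (U : set X) : hausdorff_space X ->
  (forall p p', Q p -> Q p' -> f p = f p' -> p = p') -> Q q ->
  (exists2 e, 0 < e & forall p, Q p -> d p q < e -> U (f p)) ->
  exists2 V, nbhs (f q) V & forall p, Q p -> V (f p) -> U (f p).
Proof.
move=> hX finj Qq [e e0 eU]; apply: contrapT => noV.
pose S V := [set p | [/\ Q p, V (f p) & ~ U (f p)]].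
have PF : ProperFilter (filter_from (nbhs (f q)) S).
  apply: filter_from_proper.
    apply: filter_from_filter; first by exists setT; exact: filterT.
    move=> A B FA FB; exists (A `&` B); first exact: filterI.
    by move=> x [Qx [Ax Bx] nUx].
  move=> V Vq; apply: contrapT => SV; apply: noV; exists V => // p Qp Vp.
  by apply: contrapT => nU; apply: SV; exists p.
have [G [GU FG]] := ultraFilterLemma PF.
have GS V : nbhs (f q) V -> G (S V) by move=> Vq; apply: FG; exists V.
have GQ : G Q by apply: filterS (GS setT filterT) => x [].
have [q' Qq' Gq'] := Qcompact GU GQ.
suff qq' : q = q'.
  have [p [/= pe [Qp _ []]]] := filter_ex (filterI (Gq' e e0) (GS _ filterT)).
  by apply: eU => //; rewrite qq'.
apply: finj => //; apply: hX => A B /GS GA /(fcont Qq')[e' e'0 e'B].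
have [p [/= pe [Qp Ap _]]] := filter_ex (filterI (Gq' e' e'0) GA).
by exists (f p); split=> //; exact: e'B.
Qed.

End ultra_compact.

Section l1_norm.
Variable R : realType.
Implicit Types p q r : {poly R}.

Definition l1 p : R := \sum_(i < size p) `|p`_i|.

Lemma l1_widen n p : (size p <= n)%N -> l1 p = \sum_(i < n) `|p`_i|.
Proof.
move=> pn; rewrite /l1 (big_ord_widen n (fun i => `|p`_i|) pn) big_mkcond.
apply: eq_bigr => i _; case: ifPn => //; rewrite -leqNgt => /leq_sizeP ->//.
by rewrite normr0.
Qed.

Lemma l1_ge0 p : 0 <= l1 p. Proof. exact: sumr_ge0. Qed.

Lemma l1_0 : l1 0 = 0. Proof. by rewrite /l1 size_poly0 big_ord0. Qed.

Lemma l1_eq0 p : l1 p = 0 -> p = 0.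
Proof.
move=> /eqP; rewrite psumr_eq0// => /allP p0; apply/polyP => i; rewrite coef0.
have [pi|ip] := leqP (size p) i; first by move: pi => /leq_sizeP ->.
have /(_ (mem_index_enum (Ordinal ip))) := p0 (Ordinal ip).
by rewrite normr_eq0 => /eqP.
Qed.

Lemma l1N p : l1 (- p) = l1 p.
Proof.
by rewrite /l1 size_polyN; apply: eq_bigr => i _; rewrite coefN normrN.
Qed.

Lemma l1_distC p q : l1 (p - q) = l1 (q - p).
Proof. by rewrite -l1N opprB. Qed.

Lemma l1D p q : l1 (p + q) <= l1 p + l1 q.
Proof.
have pq := size_polyD p q; have := leq_maxl (size p) (size q).
have := leq_maxr (size p) (size q); set n := maxn _ _ in pq * => qn pn.
rewrite (l1_widen pq) (l1_widen pn) (l1_widen qn) -big_split /=.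
by apply: ler_sum => i _; rewrite coefD ler_normD.
Qed.

Lemma l1_triangle p q r : l1 (p - r) <= l1 (p - q) + l1 (q - r).
Proof. by rewrite -{1}[p](subrK q) -addrA l1D. Qed.

Lemma coef_le_l1 p i : `|p`_i| <= l1 p.
Proof.
have [pi|ip] := leqP (size p) i.
  by move: pi => /leq_sizeP ->//; rewrite normr0 l1_ge0.
by rewrite /l1 (bigD1 (Ordinal ip))//= lerDl sumr_ge0.
Qed.

(** The union of the l1 balls of radius [1 / n] in dimension [n]; for [n = 0] the size condition
    leaves only the zero polynomial. *)
Definition shrinking_balls :=
  [set p : {poly R} | exists2 n, (size p <= n)%N & n%:R * l1 p <= 1].

Lemma ultra_bounded_cvg (T : Type) (G : set_system T) (h : T -> R) (M : R) :
  UltraFilter G -> G [set p | `|h p| <= M] ->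
  exists l, forall e, 0 < e -> G [set p | `|h p - l| < e].
Proof.
move=> GU GM.
have [] := @segment_compact R (- M) M (h @ G) _ _.
  rewrite /fmap /=; apply: (@filterS _ G _ [set p | `|h p| <= M]) GM => p /=.
  by rewrite in_itv /= -ler_norml.
move=> l [_ lG]; exists l => e e0.
have [//|Gn] := in_ultra_setVsetC [set p | `|h p - l| < e] GU.
have [y [/= + le]] := lG [set y : R | ~ (`|y - l| < e)] (ball (l : R) e) Gn
  (nbhsx_ballx (l : R) e e0).
by move: le; rewrite /ball /= distrC.
Qed.

(** An ultrafilter containing one of the finite-dimensional balls converges coefficientwise; one
    containing none has [n] tending to infinity, hence norms tending to 0. *)
Lemma shrinking_balls_ultra_compact :
  ultra_compact (fun p q => l1 (p - q)) shrinking_balls.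
Proof.
move=> G GU GQ.
pose Q n := [set p : {poly R} | (size p <= n)%N /\ n%:R * l1 p <= 1].
have [[n GQn]|noQ] := pselect (exists n, G (Q n)); last first.
  exists 0; first by exists 0%N; rewrite ?size_poly0// mul0r.
  move=> e e0; pose N := (Num.truncn e^-1).+1.
  have GnQ k : G (~` Q k).
    have [Qk|//] := in_ultra_setVsetC (Q k) GU.
    by exfalso; apply: noQ; exists k.
  have : G [set p | forall i : 'I_N, (~` Q i) p].
    by apply: filter_forall => i; exact: GnQ.
  apply: filterS2 GQ => p [n pn np] /= nQ; rewrite subr0.
  have Nn : (N <= n)%N.
    by rewrite leqNgt; apply/negP => nN; exact: (nQ (Ordinal nN)).
  have Ne : e^-1 < n%:R.
    by rewrite (lt_le_trans (truncnS_gt _))// ler_nat.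
  rewrite ltNge; apply/negP => ep; have : 1 < n%:R * l1 p.
    by rewrite (lt_le_trans _ (ler_wpM2l _ ep))// -ltr_pdivrMr// div1r.
  by rewrite ltNge np.
have GM i : G [set p : {poly R} | `|p`_i| <= 1].
  apply: filterS GQn => p [pn np] /=; case: n pn np => [|n] pn np.
    by move: pn; rewrite leqn0 size_poly_eq0 => /eqP ->; rewrite coef0 normr0.
  rewrite (le_trans (coef_le_l1 _ _))// (le_trans _ np)// ler_peMl ?l1_ge0//.
  by rewrite ler1n.
have /choice[l lP] i := ultra_bounded_cvg GU (GM i).
pose q := \poly_(i < n) l i.
have qn : (size q <= n)%N := size_poly _ _.
have Gq e : 0 < e -> G [set p | l1 (p - q) < e].
  (* The denominator [n.+1] covers [n = 0] and keeps the sum of [n] terms strictly below [e]. *)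
  move=> e0; have e'0 : 0 < e / n.+1%:R by rewrite divr_gt0.
  have : G [set p : {poly R} | forall i : 'I_n, `|p`_i - l i| < e / n.+1%:R].
    by apply: filter_forall => i; exact: lP.
  apply: filterS2 GQn => p [pn _] /= pl.
  have /l1_widen -> : (size (p - q)%R <= n)%N.
    by rewrite (leq_trans (size_polyD _ _))// size_polyN geq_max pn.
  apply: (@le_lt_trans _ _ (\sum_(i < n) e / n.+1%:R)).
    by apply: ler_sum => i _; rewrite coefB coef_poly ltn_ord ltW// pl.
  rewrite sumr_const card_ord -[ltLHS]mulr_natl mulrCA gtr_pMr//.
  by rewrite ltr_pdivrMr// mul1r ltr_nat.
exists q => //; exists n => //; apply/ler_addgt0Pr => e e0.
have e'0 : 0 < e / n.+1%:R by rewrite divr_gt0.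
have [p [/= [pn np] pq]] := filter_ex (filterI GQn (Gq _ e'0)).
have /(ler_wpM2l (ler0n R n)) : l1 q <= l1 p + l1 (p - q).
  by rewrite l1_distC -{1}[q](subrK p) addrC l1D.
move=> /le_trans; apply; rewrite mulrDr lerD//.
rewrite (le_trans (ler_wpM2l _ (ltW pq)))// mulrCA ler_piMr ?(ltW e0)//.
by rewrite ler_pdivrMr// mul1r ler_nat.
Qed.

End l1_norm.

(** * Covering dimension *)

Section infinite_dimension.
Variables (R : realType) (T : topologicalType) (g : T -> {poly R}).
Hypothesis g_onto : forall q, shrinking_balls q -> exists x, g x = q.
Hypothesis g_in : forall x, shrinking_balls (g x).
Hypothesis g_nbhs : forall x (U : set T),
  nbhs x U <-> exists2 e : R, 0 < e & [set y | l1 (g x - g y) < e] `<=` U.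

(** Points [x n] whose balls of radius [1 / (n + 1)] fit in no member would accumulate at some [y],
    but a ball around [y] does fit in a member. *)
Lemma lebesgue_number (V : set (set T)) : open_cover V ->
  exists2 e : R, 0 < e &
    forall x, exists2 B, V B & [set y | l1 (g x - g y) < e] `<=` B.
Proof.
move=> [Vo Vcover]; apply: contrapT => H.
have /choice[x xP] n : exists x, forall B, V B ->
    ~ [set y | l1 (g x - g y) < n.+1%:R^-1] `<=` B.
  apply: contrapT => Hn; apply: H; exists n.+1%:R^-1; first by rewrite invr_gt0.
  move=> x; apply: contrapT => Hx; apply: Hn; exists x => B VB xB.
  by apply: Hx; exists B.
have [G [GU FG]] := @ultraFilterLemma _ ((g \o x) @ \oo) _.
have GQ : G (@shrinking_balls R).
  by apply: FG; exists 0%N => // n _; exact: g_in.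
have [q /g_onto[y <-] Gy] := shrinking_balls_ultra_compact GU GQ.
have [B VB By] : (\bigcup_(A in V) A) y by rewrite Vcover.
have /g_nbhs[e e0 eB] : nbhs y B.
  by apply: open_nbhs_nbhs; split=> //; exact: Vo.
have e20 : 0 < e / 2 by rewrite divr_gt0.
have Gx : G ((g \o x) @` [set n | n.+1%:R^-1 < e / 2]).
  apply: FG; have : \forall n \near \oo, n.+1%:R^-1 < e / 2.
    exact: near_infty_natSinv_lt (PosNum e20).
  by apply: filterS => n ne; exists n.
have [p [/= + [n /= ne pE]]] := filter_ex (filterI (Gy _ e20) Gx).
rewrite -pE => ye.
apply: (xP n B VB) => z /= nz; apply: eB => /=.
rewrite [e]splitr (le_lt_trans (l1_triangle _ (g (x n)) _))// ltrD//.
  by rewrite l1_distC.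
exact: lt_trans ne.
Qed.

(* The grid of mesh [1 / (N m^2)] on the cube [0 <= p_i <= 1 / m^2], all of
   whose points satisfy [m * |p|_1 <= 1]; [minn] makes it total in [v]. *)
Definition grid_point m N (v : 'I_m -> nat) : {poly R} :=
  \poly_(i < m) ((oapp (fun j : 'I_m => minn (v j) N) 0 (insub i))%:R /
                 (N * m ^ 2)%:R).

Lemma coef_grid_point m N (v : 'I_m -> nat) (i : 'I_m) :
  (grid_point N v)`_i = (minn (v i) N)%:R / (N * m ^ 2)%:R.
Proof.
rewrite coef_poly ltn_ord insubT //= => ?; congr (_%:R / _); congr minn.
by congr v; exact/val_inj.
Qed.

Lemma grid_point_in m N (v : 'I_m -> nat) : (0 < N)%N ->
  shrinking_balls (grid_point N v).
Proof.
case: m v => [|m] v N0.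
  by exists 0%N; rewrite ?size_poly// mul0r.
exists m.+1; first exact: size_poly.
rewrite (l1_widen (size_poly _ _)).
apply: (@le_trans _ _ (m.+1%:R * \sum_(i < m.+1) (m.+1 ^ 2)%:R^-1)).
  rewrite ler_wpM2l//; apply: ler_sum => i _; rewrite coef_grid_point.
  rewrite ger0_norm ?divr_ge0// ler_pdivrMr ?ltr0n ?muln_gt0 ?N0// natrM.
  rewrite mulrCA mulVf ?mulr1 ?pnatr_eq0// ler_nat; exact: geq_minr.
by rewrite sumr_const card_ord -[_^-1 *+ _]mulr_natl natrX mulrA -expr2 mulfV//.
Qed.

Lemma l1_grid_point m N (v w : 'I_m -> nat) : (0 < N)%N -> (0 < m)%N ->
  (forall i, (v i <= (w i).+1)%N) -> (forall i, (w i <= (v i).+1)%N) ->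
  l1 (grid_point N v - grid_point N w) <= N%:R^-1.
Proof.
move=> N0 m0 vw wv.
have /l1_widen -> : (size (grid_point N v - grid_point N w)%R <= m)%N.
  rewrite (leq_trans (size_polyD _ _))// size_polyN geq_max.
  by rewrite !size_poly.
apply: (@le_trans _ _ (\sum_(i < m) (N * m ^ 2)%:R^-1)).
  apply: ler_sum => i _; rewrite coefB !coef_grid_point -mulrBl normrM normfV.
  rewrite (ger0_norm (ler0n _ _)) ler_piMl ?invr_ge0//.
  have := vw i; have := wv i; move: (v i) (w i) => a b ba ab.
  have ab1 : (minn a N <= (minn b N).+1)%N by lia.
  have ba1 : (minn b N <= (minn a N).+1)%N by lia.
  move: ab1 ba1; rewrite -!(ler_nat R) -!natr1 => ab1 ba1.
  by rewrite ler_norml; apply/andP; split; lra.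
rewrite sumr_const card_ord -[_^-1 *+ _]mulr_natl natrM invfM mulrCA.
rewrite ler_piMr ?invr_ge0// ler_pdivrMr ?ltr0n ?expn_gt0 ?m0// mul1r.
by rewrite ler_nat -{1}(expn1 m) leq_pexp2l.
Qed.

Lemma shrinking_balls_infinite_dimensional : infinite_dimensional T.
Proof.
(* A cube of dimension [n.+1] gives [n.+2] members with a common point, one too many. *)
move=> n dimT; pose m := n.+1.
pose c : R := (m ^ 2)%:R^-1.
have c0 : 0 < c by rewrite invr_gt0 ltr0n.
(* With [c] the side of the cube, [lo i] misses the face [p_i = c] and [hi i] misses [p_i = 0]. *)
pose lo (i : 'I_m) := [set x | (g x)`_i < c].
pose hi (i : 'I_m) := [set x | 0 < (g x)`_i].
pose U (S : {set 'I_m}) :=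
  [set x | forall i, if i \in S then lo i x else hi i x].
have near_coef x e (i : nat) : 0 < e ->
    nbhs x [set y | `|(g x)`_i - (g y)`_i| < e].
  move=> e0; apply/g_nbhs; exists e => // y /=.
  by apply: le_lt_trans; rewrite -coefB coef_le_l1.
have Uopen S : open (U S).
  rewrite openE => x Ux; rewrite /interior /=; apply: filter_forall => i.
  have := Ux i; case: ifP => iS xi.
    have := near_coef x (c - (g x)`_i) i; rewrite subr_gt0 => /(_ xi).
    apply: filterS => y /=; rewrite /lo /= ltr_norml => /andP[+ _]; lra.
  have := near_coef x (g x)`_i i xi.
  by apply: filterS => y /=; rewrite /hi /= ltr_norml => /andP[_]; lra.
have [|V [_ Vcover Vref Vmult]] :=
    dimT (range U) (finite_image _ finite_finset).
  split=> [_ [S _ <-]//|]; apply/seteqP; split=> // x _.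
  exists (U [set i | `[< lo i x >]]%SET).
    by exists [set i | `[< lo i x >]]%SET.
  move=> i; rewrite inE; case: asboolP => //= /negP; rewrite /lo /hi /= -leNgt.
  exact: lt_le_trans.
have [e e0 eV] := lebesgue_number Vcover.
pose N := (Num.truncn e^-1).+1.
have Ne : N%:R^-1 < e.
  by rewrite -[ltRHS]invrK ltf_pV2 ?posrE ?invr_gt0// truncnS_gt.
have /choice[X XP] (v : 'I_m -> nat) : exists x, g x = grid_point N v.
  by apply: g_onto; exact: grid_point_in.
have /choice[B BP] x : exists B, V B /\ [set y | l1 (g x - g y) < e] `<=` B.
  by have [B VB xB] := eV x; exists B.
have B_self x : B x x.
  by have [_] := BP x; apply; rewrite /= subrr l1_0.
(* [F v] depends only on the member [B (X v)], so distinct values come from distinct members. *)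
pose F (v : 'I_m -> nat) (i : 'I_m) : rat := `[< B (X v) `<=` hi i >]%:R.
have F0 v i : v i = 0%N -> F v i = 0.
  move=> vi; rewrite /F asboolF// => /(_ _ (B_self _)).
  by rewrite /hi /= XP coef_grid_point vi min0n mul0r ltxx.
have F1 v i : v i = N -> F v i = 1.
  move=> vi; rewrite /F asboolT//.
  have [VB _] := BP (X v); have [_ [S _ <-] BU] := Vref _ VB.
  move=> y /BU /(_ i); case: ifP => // iS.
  have := BU _ (B_self _) i; rewrite iS /lo /= XP coef_grid_point vi minnn.
  by rewrite natrM invfM mulrA mulfV ?pnatr_eq0// mul1r ltxx.
have [v [vinj vclose]] := cube_distinct_values F0 F1.
(* All vertices of the simplex are within [e] of this one, which therefore lies in all their
   members. *)
pose x := X (v ord0).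
have Bx k : B (X (v k)) x.
  have [_] := BP (X (v k)); apply => /=; rewrite !XP.
  by apply: le_lt_trans Ne; apply: l1_grid_point.
pose h (k : nat) := B (X (v (inord k))).
have hinj : {in `I_m.+1 &, injective h}.
  move=> j k /set_mem /= jm /set_mem /= km.
  move=> /(congr1 (fun C => fun i => `[< C `<=` hi i >]%:R : rat)).
  move=> /(vinj (inord j) (inord k) : _ -> _) /(congr1 val) /=.
  by rewrite !inordK.
have : (`I_m.+1 #<= `I_m)%card.
  apply: card_le_trans (Vmult x); rewrite -(card_le_eql (inj_card_eq hinj)).
  apply: subset_card_le => _ [k _ <-]; split; last exact: Bx.
  by have [] := BP (X (v (inord k))).
by rewrite card_le_II ltnn.
Qed.

End infinite_dimension.

(** * Linear combinations of a bounded sequence *)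

Section poly_combination.
Variables (R : realType) (E : tvsType R) (u : nat -> E).

Definition poly_combination (p : {poly R}) : E :=
  \sum_(i < size p) p`_i *: u i.

Lemma poly_combination_widen n (p : {poly R}) : (size p <= n)%N ->
  poly_combination p = \sum_(i < n) p`_i *: u i.
Proof.
move=> pn; rewrite /poly_combination.
rewrite (big_ord_widen n (fun i => p`_i *: u i) pn) big_mkcond.
apply: eq_bigr => i _; case: ifPn => //.
by rewrite -leqNgt => /leq_sizeP ->//; rewrite scale0r.
Qed.

Lemma poly_combinationB (p q : {poly R}) :
  poly_combination (p - q) = poly_combination p - poly_combination q.
Proof.
have pq := size_polyD p (- q); have := leq_maxl (size p) (size (- q)).
have := leq_maxr (size p) (size (- q)); set n := maxn _ _ in pq * => qn pn.
rewrite size_polyN in qn.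
rewrite (poly_combination_widen pq) (poly_combination_widen pn).
rewrite (poly_combination_widen qn) -sumrB.
by apply: eq_bigr => i _; rewrite coefB scalerBl.
Qed.

Lemma poly_combination_inj (B : set E) : linearly_independent B ->
  injective u -> (forall k, B (u k)) -> injective poly_combination.
Proof.
move=> Bfree uinj Bu p q pq; apply/eqP; rewrite -subr_eq0; apply/eqP.
move: pq => /eqP; rewrite -subr_eq0 -poly_combinationB => /eqP.
move: (p - q) => {p q} p p0; apply/polyP => i; rewrite coef0.
have [pi|ip] := leqP (size p) i; first by move: pi => /leq_sizeP ->.
pose s := map u (iota 0 (size p)).
have idx j : (j < size p)%N -> index (u j) s = j.
  move=> jp; rewrite index_map//.
  by rewrite -[X in index X](nth_iota 0 0 jp) index_uniq ?size_iota ?iota_uniq.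
(* Independence takes coefficients as a function on [E]; the one of [x] is read off at its position
   in [s]. *)
rewrite -(idx i ip); apply: (Bfree s (fun x => p`_(index x s))).
- by rewrite map_inj_uniq ?iota_uniq.
- by move=> _ /mapP[k _ ->].
- rewrite -[RHS]p0 /poly_combination -(big_mkord xpredT (fun i => p`_i *: u i)).
  rewrite big_map /index_iota subn0 big_seq [RHS]big_seq.
  apply: eq_bigr => j.
  by rewrite mem_iota add0n => /idx ->.
- by rewrite map_f// mem_iota.
Qed.

(** If all [u k / (n + 1)] lie in an absolutely convex [C], so do the combinations of polynomials of
    l1 norm at most [1 / (n + 1)]. *)
Lemma poly_combination_continuous :
  (forall V, nbhs 0 V -> exists n, forall k, V (n.+1%:R^-1 *: u k)) ->
  forall q V, nbhs (poly_combination q) V ->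
  exists2 e : R, 0 < e &
    forall p, l1 (p - q) < e -> V (poly_combination p).
Proof.
move=> ubound q V /(nbhsB (- poly_combination q)); rewrite addNr.
move=> /absolutely_convex_nbhs[C [C0 CV Cac]].
have [n nC] := ubound C C0; exists n.+1%:R^-1; first by rewrite invr_gt0.
move=> p pq; suff /CV[v Vv] : C (poly_combination p - poly_combination q).
  by rewrite addrC => /addIr <-.
rewrite -poly_combinationB /poly_combination.
rewrite (_ : \sum_(i < _) _ = \sum_(i < size (p - q))
    (n.+1%:R * (p - q)`_i) *: (n.+1%:R^-1 *: u i)); last first.
  by apply: eq_bigr => i _; rewrite scalerA mulrAC mulfV ?mul1r// pnatr_eq0.
apply: (absolutely_convex_sum (y := fun i => n.+1%:R^-1 *: u i)
  (c := fun i => n.+1%:R * (p - q)`_i)) => //.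
under eq_bigr do rewrite normrM normr_nat.
by rewrite -big_distrr /= -ler_pdivlMl// mulr1 ltW.
Qed.

End poly_combination.

(** * The compact image in [E] and its metric *)

Lemma nbhs_set_type (X : topologicalType) (K : set X) (x : set_type K)
    (U : set (set_type K)) :
  nbhs x U <-> exists2 V, nbhs (set_val x) V & forall y, V (set_val y) -> U y.
Proof.
split; last first.
  move=> [V xV VU]; apply: (@filterS _ (nbhs x) _ (set_val @^-1` V)) => //.
  exact: initial_continuous.
rewrite nbhsE => -[W [[V Vopen <-] Vx] VU]; exists V; last by move=> y /VU.
by exists V.
Qed.

Theorem theorem4p9 (R : realType) (d : Order.disp_t)
    (P : POrderedTopological.type d)
    (P_directed : directed (fun p q : P => (p <= q)%O))
    (P_tychonoff : tychonoff_space P)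
    (P_second_countable : @second_countable P)
    (P_seq_bounded : forall (u : nat -> P) (l : P),
       u n @[n --> \oo] --> l ->
       bounded_above (fun p q : P => (p <= q)%O) (range u))
    (E : tvsType R)
    (E_hausdorff : hausdorff_space E)
    (E_uncountable : uncountably_dimensional E)
    (E_base : has_base_of_type (fun p q : P => (p <= q)%O) E) :
  exists K : set E,
    [/\ compact K, metrizable R (set_type K) & infinite_dimensional (set_type K)].
Proof.
have [A radA] := radial_network P_second_countable P_seq_bounded (E_base 0).
have [B [Bfree _] Bunc] := E_uncountable.
have [u [uinj uB ubound]] := bounded_sequence radA Bunc.
have finj := poly_combination_inj Bfree uinj uB.
have fcont q V : shrinking_balls q -> nbhs (poly_combination u q) V ->
    exists2 e : R, 0 < e & forall p, shrinking_balls p -> l1 (p - q) < e ->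
      V (poly_combination u p).
  move=> _ /(poly_combination_continuous ubound)[e e0 eV].
  by exists e => // p _ /eV.
pose K := poly_combination u @` @shrinking_balls R.
have Qc := @shrinking_balls_ultra_compact R.
have /choice[g gP] (x : set_type K) : exists p,
    shrinking_balls p /\ poly_combination u p = set_val x.
  by have [p Qp px] := set_valP x; exists p; split=> //; rewrite px.
have g_onto q : shrinking_balls q -> exists x, g x = q.
  move=> Qq; have Kq : K (poly_combination u q) by exists q.
  exists (SigSub (mem_set Kq)); apply: finj.
  by have [_ ->] := gP (SigSub (mem_set Kq)).
have g_nbhs x (U : set (set_type K)) : nbhs x U <->
    exists2 e : R, 0 < e & [set y | l1 (g x - g y) < e] `<=` U.
  have [Qx gx] := gP x; rewrite nbhs_set_type -gx; split=> [[V]|[e e0 eU]].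
    move=> /(fcont _ _ Qx)[e e0 eV] VU; exists e => // y /= xy.
    have [Qy gy] := gP y; apply: VU; rewrite -gy; apply: eV => //.
    by rewrite l1_distC.
  (* As a subset of [E], this is [U] together with all points outside [K]. *)
  pose W := [set v | forall y, set_val y = v -> U y].
  have [||V xV VU] := image_nbhs (U := W) Qc fcont E_hausdorff _ Qx.
  - by move=> p p' _ _; exact: finj.
  - exists e => // p Qp px y; have [_ <-] := gP y => /finj gyp.
    by apply: eU; rewrite /= gyp l1_distC.
  exists V => // y Vy; have [Qy gy] := gP y.
  by apply: (VU (g y) Qy); rewrite gy.
exists K; split.
- exact: image_compact Qc fcont.
- exists (fun x y => l1 (g x - g y)); split => //.
  + by move=> x y; exact: l1_ge0.
  + move=> x y; split=> [/l1_eq0/eqP|->]; last by rewrite subrr l1_0.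
    rewrite subr_eq0 => /eqP gxy; apply: val_inj.
    by rewrite -[LHS](gP x).2 -[RHS](gP y).2 gxy.
  + by move=> x y; exact: l1_distC.
  + by move=> x y z; exact: l1_triangle.
apply: (shrinking_balls_infinite_dimensional g_onto _ g_nbhs).
by move=> x; have [] := gP x.
Qed.
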